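(* Let $\kappa,\ell\in\mathbb N$, let $h\in\mathcal F(\kappa,\ell)$ be a permutative block code, let $Y\subseteq\mathcal A_\kappa^{\mathbb Z}$ be a subshift and let $X=\eta_h^{-1}(Y)$. Define $$\gamma:X\to Y\times\mathcal A_\kappa^{\ell-1},\qquad x\mapsto\left(\eta_h(x),x_{[0,\ell-2]}\right)$$ and $$T:Y\times\mathcal A_\kappa^{\ell-1}\to Y\times\mathcal A_\kappa^{\ell-1},\qquad (y,u)\mapsto\left(\sigma(y),\Phi_{y_0}(u)\right).$$ Then $\gamma$ and $T$ are homeomorphisms, and $\gamma$ is a conjugacy between $(X,\sigma)$ and $(Y\times\mathcal A_\kappa^{\ell-1},T)$, i.e. $\gamma\circ\sigma=T\circ\gamma$ on $X$.
   Context: $\mathbb N=\{1,2,\dots\}$, $\mathcal A_\kappa=\{0,\dots,\kappa-1\}$, and $\mathcal A_\kappa^*$ is the set of finite words (including the empty word); $|w|$ is the length of $w=w_0\ldots w_{|w|-1}$ and $x_{[k,n]}=x_k\ldots x_n$. $\mathcal A_\kappa^{\mathbb Z}$ carries the product topology, and $\mathcal A_\kappa^{\ell-1}$ the discrete topology; $\sigma$ is the left shift, $\sigma(x)_n=x_{n+1}$. A subshift is a closed $\sigma$-invariant subset ($\sigma(Y)=Y$) of $\mathcal A_\kappa^{\mathbb Z}$. A block code of length $\ell$ is a map $h:\mathcal A_\kappa^\ell\to\mathcal A_\kappa$; the set of these is $\mathcal F(\kappa,\ell)$. The sliding block code $\eta_h:\mathcal A_\kappa^{\mathbb Z}\to\mathcal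 A_\kappa^{\mathbb Z}$ is $\eta_h(x)_n=h(x_{[n,n+\ell-1]})$. $h$ is permutative if for every $u\in\mathcal A_\kappa^{\ell-1}$ both maps $a\mapsto h(ua)$ and $a\mapsto h(au)$ are permutations of $\mathcal A_\kappa$. For permutative $h$, $w\in\mathcal A_\kappa^*$ and $u\in\mathcal A_\kappa^{\ell-1}$, there is a unique word $\xi^u(w)\in\mathcal A_\kappa^{|w|+\ell-1}$ starting with $u$ and satisfying $h(\xi^u(w)_{[n,n+\ell-1]})=w_n$ for $0\le n\le|w|-1$; the prefix permutation $\Phi_w=\Phi_w^{(h)}$ of $\mathcal A_\kappa^{\ell-1}$ sends $u$ to the last $\ell-1$ letters of $\xi^u(w)$. $\Phi_{y_0}$ is the prefix permutation of the one-letter word $y_0$. *)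

(* Defs.v *)
From mathcomp Require Import all_boot all_order all_algebra.
From mathcomp Require Import all_classical all_reals all_analysis.

Set Implicit Arguments.
Unset Strict Implicit.
Unset Printing Implicit Defensive.

Import GRing.Theory.

Local Open Scope classical_set_scope.

(* [discrete_topology T] is [T] with its discrete topology; [prod_topology]
   (notation [{ptws _ -> _}]) is the product topology, which has to be requested
   explicitly because plain arrow types do not carry it by default. *)
Definition word (k m : nat) := discrete_topology (m.-tuple 'I_k).

Definition full_shift (k : nat) := {ptws int -> discrete_topology 'I_k}.

Definition left_shift (k : nat) (x : full_shift k) : full_shift k :=
  fun n => x (n + 1)%R.

Definition subshift (k : nat) (Y : set (full_shift k)) : Prop :=
  closed Y /\ [set left_shift x | x in Y] = Y.

Definition block_code (k l : nat) := l.-tuple 'I_k -> 'I_k.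

(* [window x n m] is x_[n, n + m - 1]. *)
Definition window (k : nat) (x : full_shift k) (n : int) (m : nat) :
    m.-tuple 'I_k :=
  [tuple x (n + (i : nat)%:Z)%R | i < m].

Definition sliding_block_code (k l : nat) (h : block_code k l)
    (x : full_shift k) : full_shift k :=
  fun n => h (window x n l).

(* [factor a v n m] is v_[n, n + m - 1]; the letter [a] is a dummy, relevant only
   when this factor overflows [v]. *)
Definition factor (k : nat) (a : 'I_k) (v : seq 'I_k) (n m : nat) :
    m.-tuple 'I_k :=
  [tuple nth a v (n + i) | i < m].

(* For l > 0 the two [factor]s are the whole words ua and au, seen in A^l. *)
Definition permutative (k l : nat) (h : block_code k l) : Prop :=
  forall u : l.-1.-tuple 'I_k,
    bijective (fun a => h (factor a (rcons u a) 0 l)) /\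
    bijective (fun a => h (factor a (a :: u) 0 l)).

Definition is_xi (k l : nat) (h : block_code k l) (w : seq 'I_k)
    (u : l.-1.-tuple 'I_k) (v : (size w + l.-1).-tuple 'I_k) : bool :=
  (take l.-1 v == u) &&
  [forall n : 'I_(size w),
     h (factor (tnth (in_tuple w) n) v n l) == tnth (in_tuple w) n].

(* The default value [u] is never taken when h is permutative and l > 0, see
   [xi_exists_unique]. *)
Definition prefix_perm (k l : nat) (h : block_code k l) (w : seq 'I_k)
    (u : word k l.-1) : word k l.-1 :=
  if [pick v | is_xi h (w := w) u v] is Some v
  then [tuple tnth v (rshift (size w) i) | i < l.-1]
  else u.

Definition homeomorphism (U V : topologicalType) (A : set U) (B : set V)
    (f : U -> V) : Prop :=
  [/\ set_bij A B f,
      {within A, continuous f} &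
      exists2 g : V -> U, {in A, cancel f g} & {within B, continuous g}].

Definition conjugacy (U V : topologicalType) (A : set U) (f : U -> U)
    (B : set V) (g : V -> V) (phi : U -> V) : Prop :=
  [/\ set_fun A A f, set_fun B B g, homeomorphism A B phi &
      forall x, A x -> phi (f x) = g (phi x)].

Definition gamma_map (k l : nat) (h : block_code k l) (x : full_shift k) :
    full_shift k * word k l.-1 :=
  (sliding_block_code h x, window x 0%R l.-1).

Definition skew_map (k l : nat) (h : block_code k l)
    (p : full_shift k * word k l.-1) : full_shift k * word k l.-1 :=
  (left_shift p.1, prefix_perm h [:: p.1 0%R] p.2).

Lemma xi_exists_unique (k l : nat) (h : block_code k l) (w : seq 'I_k)
    (u : l.-1.-tuple 'I_k) :
  (0 < l)%N -> permutative h -> exists! v, is_xi h (w := w) u v.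
Proof.
move=> l_gt0 hP.
have nth_factor (a : 'I_k) v n (i : 'I_l) :
    tnth (factor a v n l) i = nth a v (n + i) by rewrite tnth_mktuple.
have step (t : seq 'I_k) b : (l.-1 <= size t)%N ->
    exists a, h (factor b (rcons t a) (size t - l.-1) l) = b /\
      forall a', h (factor b (rcons t a') (size t - l.-1) l) = b -> a' = a.
  move=> st; have sd : size (drop (size t - l.-1) t) == l.-1.
    by rewrite size_drop subKn.
  have [[g gK Kg] _] := hP (Tuple sd).
  have E a : factor a (rcons (Tuple sd) a) 0 l
            = factor b (rcons t a) (size t - l.-1) l.
    apply: eq_from_tnth => i; rewrite !nth_factor add0n !nth_rcons.
    rewrite (eqP sd) nth_drop.
    have : (i <= l.-1)%N by rewrite -ltnS prednK.
    rewrite leq_eqVlt => /orP[/eqP->|il].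
      by rewrite ltnn eqxx subnK// ltnn eqxx.
    have lt : (size t - l.-1 + i < size t)%N by rewrite -{2}(subnK st) ltn_add2l.
    by rewrite il lt; exact: set_nth_default.
  exists (g b); split; first by rewrite -E Kg.
  by move=> a'; rewrite -E => <-; rewrite gK.
pose ok (w v : seq 'I_k) := [/\ size v = (size w + l.-1)%N, take l.-1 v = u &
  forall n b, (n < size w)%N -> h (factor b v n l) = nth b w n].
have factor_def (b c : 'I_k) v n :
    (n + l <= size v)%N -> factor b v n l = factor c v n l.
  move=> nv; apply: eq_from_tnth => i; rewrite !nth_factor.
  by apply: set_nth_default; rewrite (leq_trans _ nv)// ltn_add2l.
have bound w' n : (n < size w')%N -> (n + l <= size w' + l.-1)%N.
  by move=> nw; rewrite -{1}(prednK l_gt0) addnS -addSn leq_add2r.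
have okP (v : (size w + l.-1).-tuple 'I_k) :
    is_xi h u v <-> ok w v.
  split.
    move=> /andP[/eqP tv /forallP hv]; split; rewrite ?size_tuple// => n b nw.
    have /eqP := hv (Ordinal nw).
    rewrite (tnth_nth b)/= => <-; congr h; apply: factor_def.
    by rewrite size_tuple; exact: bound.
  move=> [_ tv hv]; apply/andP; split; first exact/eqP.
  by apply/forallP => n; apply/eqP; rewrite hv //; exact/esym/tnth_nth.
have ok_rcons w' b v : ok (rcons w' b) v ->
    exists t a, v = rcons t a /\ ok w' t.
  move=> [sv tv hv]; case: (lastP v) sv tv hv => [|t a].
    by rewrite size_rcons.
  rewrite !size_rcons addSn => -[st] tv hv.
  exists t, a; split=> //; split=> //.
    by rewrite -tv -cats1 takel_cat// st leq_addl.
  move=> n c nw; have := hv n c (ltnW nw : (n < (size w').+1)%N).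
  rewrite nth_rcons nw => <-; congr h; apply: eq_from_tnth => i.
  rewrite !nth_factor nth_rcons st.
  by rewrite (leq_trans _ (bound _ _ _ nw))// ltn_add2l.
have [v [vok vuniq]] : exists v, ok w v /\ forall v', ok w v' -> v = v'.
  elim/last_ind: w {okP} => [|w' b [t [tok tuniq]]].
    exists u; split.
      by split; rewrite ?size_tuple// take_oversize ?size_tuple.
    by move=> v' [sv' tv' _]; rewrite -tv' take_oversize// sv'.
  have [st tt ht] := tok.
  have lt : (l.-1 <= size t)%N by rewrite st leq_addl.
  have [a [ha auniq]] := step t b lt.
  move: ha auniq; rewrite st addnK => ha auniq.
  exists (rcons t a); split.
    split; first by rewrite !size_rcons st addSn.
      by rewrite -cats1 takel_cat.
    move=> n c; rewrite size_rcons ltnS leq_eqVlt => /orP[/eqP->|nw].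
      rewrite nth_rcons ltnn eqxx -[RHS]ha; congr h; apply: factor_def.
      by rewrite size_rcons st -addnS prednK.
    rewrite nth_rcons nw -ht//; congr h; apply: eq_from_tnth => i.
    rewrite !nth_factor nth_rcons st.
    by rewrite (leq_trans _ (bound _ _ _ nw))// ltn_add2l.
  move=> v' v'ok; have [t' [a' [v'E t'ok]]] := ok_rcons _ _ _ v'ok.
  move: v'ok; rewrite {v'}v'E -(tuniq _ t'ok) => -[_ _ hv'].
  have := hv' (size w') b; rewrite size_rcons ltnSn => /(_ isT).
  by rewrite nth_rcons ltnn eqxx => /auniq ->.
have [sv _ _] := vok; have sv' : size v == (size w + l.-1)%N by exact/eqP.
exists (Tuple sv'); split; first exact/okP.
by move=> v' /okP v'ok; apply/val_inj; exact: vuniq.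
Qed.

(* Main.v *)
Require Import Defs.
From mathcomp Require Import all_boot all_order all_algebra.
From mathcomp Require Import all_classical all_reals all_analysis.

Local Open Scope classical_set_scope.

Set Implicit Arguments.
Unset Strict Implicit.
Unset Printing Implicit Defensive.

Import GRing.Theory.

(** Write sigma for the shift, T for the skew map and gamma for the coding map.
    All three turn out to be homeomorphisms of the full spaces (those belonging
    to Y = the full shift), and the theorem follows by restriction, because
    X = gamma^-1(Y x A^(l-1)) by definition and Y x A^(l-1) = T^-1(Y x A^(l-1))
    by shift invariance of Y ([homeomorphism_restrict]).

    - T is invertible: its inverse is (y, u) |-> (sigma^-1 y, Phi^-1 u) with Phi
      the prefix permutation of y_(-1). Phi is injective, hence bijective, since
      Phi_a(u) = v forces xi^u(a) = b v with h(b v) = a, and permutativity on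
      the left determines b, hence xi^u(a) and its prefix u
      ([prefix_perm_inj]).
    - gamma intertwines sigma and T: x_[0, l-1] starts with x_[0, l-2] and h
      sends it to eta_h(x)_0, so by uniqueness it is xi^u(y_0) for
      (y, u) = gamma(x), and its last l-1 letters are x_[1, l-1]
      ([gamma_left_shift]).
    - Let pi(y, u) be the first letter of xi^u(y_0). Then pi(gamma x) = x_0, so
      x_n = pi(gamma(sigma^n x)) = pi(T^n(gamma x)) for every integer n. This
      suggests the inverse p |-> (pi(T^n p))_n of gamma, which is continuous
      because pi and all the T^n are ([gamma_inv], [gammaK]).
    - It is a right inverse too: an induction using
      xi(T p)_i = xi(p)_(i+1) shows that the point built from p = (y, u) has
      the word xi^u(y_0) at the coordinates 0, ..., l-1
      ([window_gamma_inv]). So its image has symbol y_0 at 0 and window u; the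
      other coordinates follow by replacing p with T^n p ([gamma_invK]).

    The word length l > 0 is written m.+1 throughout, so that xi^u(a) has
    length m.+1 even for l = 1, when u is empty; pi is therefore always
    defined, whereas the first letter of u is not. *)

(** * Integer iterates of an invertible map *)

(** [g] is meant to be the inverse of [f]; taking it as an argument keeps the
    definition independent of any proof of invertibility. *)
Definition iterz (T : Type) (f g : T -> T) (n : int) : T -> T :=
  match n with Posz i => iter i f | Negz i => iter i.+1 g end.

Lemma iterz_semiconj (T U : Type) (f g : T -> T) (f' g' : U -> U)
    (phi : T -> U) :
  {morph phi : x / f x >-> f' x} -> {morph phi : x / g x >-> g' x} ->
  forall n, {morph phi : x / iterz f g n x >-> iterz f' g' n x}.
Proof.
move=> phif phig.
have iter_phi e e' : {morph phi : x / e x >-> e' x} ->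
    forall i x, phi (iter i e x) = iter i e' (phi x).
  by move=> phie; elim=> //= i IH x; rewrite phie IH.
by case=> i x; exact: iter_phi.
Qed.

Lemma iterz_add1 (T : Type) (f g : T -> T) : cancel f g -> cancel g f ->
  forall n x, iterz f g n (f x) = iterz f g (n + 1)%R x.
Proof.
move=> fK gK [i|[|i]] x; first by rewrite -PoszD addn1 /= -iterSr.
  by rewrite /= fK.
have -> : (Negz i.+1 + 1)%R = Negz i.
  by rewrite !NegzE -[i.+2]addn1 PoszD opprD addrK.
by rewrite [LHS]iterSr fK.
Qed.

Lemma continuous_iterz (T : topologicalType) (f g : T -> T) :
  continuous f -> continuous g -> forall n, continuous (iterz f g n).
Proof.
move=> cf cg.
have iter_cont (e : T -> T) : continuous e -> forall i, continuous (iter i e).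
  move=> ce; elim=> [|i IH] x; first exact: cvg_id.
  exact: (@continuous_comp _ _ _ (iter i e) e x (IH x) (ce _)).
by case=> i; exact: iter_cont.
Qed.

(** * Continuity into shift spaces *)

Lemma continuous_pair (U V W : topologicalType) (f : U -> V) (g : U -> W) :
  continuous f -> continuous g -> continuous (fun x => (f x, g x)).
Proof. by move=> cf cg x; apply: cvg_pair; [exact: cf | exact: cg]. Qed.

Lemma continuous_discrete (U : topologicalType) (A : discreteTopologicalType)
    (f : U -> A) :
  (forall x, \forall z \near x, f z = f x) -> continuous f.
Proof. by move=> fx x; apply/discrete_cvg; exact: fx. Qed.

(** A product of two discrete spaces is discrete, so [F] is continuous on it. *)
Lemma continuous_discrete2 (U : topologicalType) (A B C : discreteTopologicalType)
    (F : A -> B -> C) (f : U -> A) (g : U -> B) :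
  continuous f -> continuous g -> continuous (fun x => F (f x) (g x)).
Proof.
move=> cf cg; apply: continuous_discrete => x.
have nf : nbhs x (f @^-1` [set f x]) by apply: cf; exact: discrete_set1.
have ng : nbhs x (g @^-1` [set g x]) by apply: cg; exact: discrete_set1.
by apply: filterS (filterI nf ng) => z [/= -> ->].
Qed.

Lemma continuous_coord (k : nat) (n : int) :
  continuous (fun x : full_shift k => x n : discrete_topology 'I_k).
Proof. exact: (@proj_continuous int (fun=> discrete_topology 'I_k) n). Qed.

Lemma continuous_full_shift (k : nat) (U : topologicalType)
    (f : U -> full_shift k) :
  (forall n, continuous (fun x => f x n : discrete_topology 'I_k)) ->
  continuous f.
Proof.
move=> cf x; apply/cvg_sup => n V [_ [[W oW <-] /= Wx VW]].
apply: (@filterS _ (nbhs x) _ ((fun z => f z n) @^-1` W)).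
  by move=> z /= Wz; exact: VW.
by apply: cf; exact: open_nbhs_nbhs.
Qed.

(** A basic neighbourhood of [x] constrains finitely many coordinates, which is
    all that a window depends on. *)
Lemma near_window (k : nat) (n : int) (m : nat) (x : full_shift k) :
  \forall z \near x, window z n m = window x n m.
Proof.
have near_coord : \forall z \near x, forall i : 'I_m,
    z (n + i%:Z)%R = x (n + i%:Z)%R.
  apply (@filter_forall _ _ (fun (i : 'I_m) (z : full_shift k) =>
    z (n + i%:Z)%R = x (n + i%:Z)%R) (nbhs x) (nbhs_filter x)) => i.
  exact (@continuous_coord k (n + i%:Z)%R x _ (discrete_set1 _)).
apply: (@filterS _ _ (nbhs_filter x) _ _ _ near_coord) => z zx.
by apply: eq_from_tnth => i; rewrite !tnth_mktuple.
Qed.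

(** Restricting a global homeomorphism to a saturated pair of sets avoids any
    work in the subspace topologies. *)
Lemma homeomorphism_restrict (U V : topologicalType) (f : U -> V) (g : V -> U)
    (A : set U) (B : set V) :
  cancel f g -> cancel g f -> continuous f -> continuous g ->
  A = f @^-1` B -> homeomorphism A B f.
Proof.
move=> fK gK cf cg ->; split; last 1 first.
- by exists g; [move=> x _; exact: fK | exact: continuous_subspaceT].
- split=> [x //|x y _ _|y By]; first exact: (can_inj fK).
  by exists (g y); rewrite /= gK.
- exact: continuous_subspaceT.
Qed.

(** * The two shifts *)

Definition right_shift (k : nat) (x : full_shift k) : full_shift k :=
  fun n => x (n - 1)%R.

Lemma left_shiftK k : cancel (@left_shift k) (@right_shift k).
Proof. by move=> x; apply/funext => n; rewrite /right_shift/left_shift subrK. Qed.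

Lemma right_shiftK k : cancel (@right_shift k) (@left_shift k).
Proof. by move=> x; apply/funext => n; rewrite /right_shift/left_shift addrK. Qed.

Lemma iterz_shift k (x : full_shift k) n m :
  iterz (@left_shift k) (@right_shift k) n x m = x (m + n)%R.
Proof.
case: n => i; elim: i m => [|i IH] m; rewrite ?addr0 //.
  by rewrite [LHS](IH (m + 1)%R) -addrA -PoszD add1n.
rewrite -[LHS]/(iterz (@left_shift k) (@right_shift k) (Negz i) x (m - 1)%R).
by rewrite IH !NegzE -addrA -opprD -PoszD add1n.
Qed.

Lemma continuous_left_shift k : continuous (@left_shift k).
Proof. by apply: continuous_full_shift => n; exact: continuous_coord. Qed.

Lemma continuous_right_shift k : continuous (@right_shift k).
Proof. by apply: continuous_full_shift => n; exact: continuous_coord. Qed.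

Lemma subshift_left_shift k (Y : set (full_shift k)) y :
  subshift Y -> Y (left_shift y) <-> Y y.
Proof.
move=> [_ YE]; split=> [|Yy]; last by rewrite -YE; exists y.
by rewrite -{1}YE => -[z Yz /(can_inj (@left_shiftK k)) <-].
Qed.

(** * Prefix permutations of letters *)

(** The word xi^u(a); for permutative [h] the default value is never taken. *)
Definition xi_letter (k m : nat) (h : block_code k m.+1) (a : 'I_k)
    (u : word k m) : m.+1.-tuple 'I_k :=
  if [pick v | is_xi h (w := [:: a]) u v] is Some v then v else [tuple of a :: u].

Lemma factor_full (k l : nat) (a : 'I_k) (v : l.-tuple 'I_k) :
  Defs.factor a v 0 l = v.
Proof. by apply: eq_from_tnth => i; rewrite tnth_mktuple (tnth_nth a). Qed.

Lemma is_xi_letter (k m : nat) (h : block_code k m.+1) a u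
    (v : m.+1.-tuple 'I_k) :
  is_xi h (w := [:: a]) u v = (take m v == u) && (h v == a).
Proof.
congr andb; apply/forallP/eqP => [/(_ ord0)|hv n].
  by rewrite (tnth_nth a) /= factor_full => /eqP.
by rewrite ord1 (tnth_nth a) /= factor_full hv.
Qed.

Section PrefixPermutation.
Context (k m : nat) (h : block_code k m.+1) (hP : permutative h).

Lemma xi_letter_xi a u : is_xi h (w := [:: a]) u (xi_letter h a u).
Proof.
rewrite /xi_letter; case: pickP => // noxi.
have [v [vxi _]] := @xi_exists_unique k m.+1 h [:: a] u (ltn0Sn m) hP.
by have := noxi v; rewrite vxi.
Qed.

Lemma take_xi_letter a u : take m (xi_letter h a u) = u.
Proof. by have := xi_letter_xi a u; rewrite is_xi_letter => /andP[/eqP]. Qed.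

Lemma code_xi_letter a u : h (xi_letter h a u) = a.
Proof. by have := xi_letter_xi a u; rewrite is_xi_letter => /andP[_ /eqP]. Qed.

Lemma xi_letter_unique (u : word k m) (v : m.+1.-tuple 'I_k) :
  take m v = u -> xi_letter h (h v) u = v.
Proof.
move=> vu; have [w [_ wuniq]] :=
  @xi_exists_unique k m.+1 h [:: h v] u (ltn0Sn m) hP.
by rewrite -(wuniq _ (xi_letter_xi _ _)); apply: wuniq; rewrite is_xi_letter vu !eqxx.
Qed.

Lemma prefix_permE a u : prefix_perm h [:: a] u = behead (xi_letter h a u) :> seq _.
Proof.
have := xi_letter_xi a u.
rewrite /prefix_perm /xi_letter; case: pickP => [v _ _|noxi]; last first.
  by rewrite noxi.
apply: (@eq_from_nth _ a) => [|i]; first by rewrite size_behead !size_tuple.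
rewrite size_tuple => im.
by rewrite (nth_mktuple _ _ (Ordinal im)) (tnth_nth a) nth_behead.
Qed.

(** Left permutativity makes the step reversible: [headE] recovers the first
    letter of xi^u(a) from [a] and the remaining letters. *)
Lemma prefix_perm_inj a : injective (prefix_perm h [:: a]).
Proof.
move=> u u' /(congr1 (fun t : word k m => t : seq _)); rewrite !prefix_permE => E.
(* [g] inverts the letter map b |-> h(b v), for v the common image. *)
have [_ [g gK _]] := hP (prefix_perm h [:: a] u).
have headE v : prefix_perm h [:: a] u = behead (xi_letter h a v) :> seq _ ->
    g a = thead (xi_letter h a v).
  move=> vE; set w := xi_letter h a v.
  have wE : [tuple of thead w :: prefix_perm h [:: a] u] = w.
    by rewrite [RHS]tuple_eta; apply: val_inj; rewrite /= vE.
  rewrite -[RHS]gK -{1}(code_xi_letter a v) -/w -[in LHS]wE; congr (g (h _)).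
  exact/esym/(factor_full (thead w) [tuple of thead w :: prefix_perm h [:: a] u]).
have xiE : xi_letter h a u = xi_letter h a u'.
  rewrite [LHS]tuple_eta [RHS]tuple_eta; apply: val_inj => /=; rewrite E.
  by rewrite -!headE // prefix_permE.
by apply: val_inj; rewrite /= -(take_xi_letter a u) xiE take_xi_letter.
Qed.

End PrefixPermutation.

Lemma take_window (k : nat) (x : full_shift k) (n : int) (m : nat) :
  take m (window x n m.+1) = window x n m.
Proof.
apply: (@eq_from_nth _ (x n)) => [|i].
  by rewrite size_take !size_tuple ltnSn.
rewrite size_take size_tuple ltnSn => im.
rewrite nth_take // (nth_mktuple _ _ (Ordinal (ltnW im : (i < m.+1)%N))).
by rewrite (nth_mktuple _ _ (Ordinal im)).
Qed.

(** * The skew product and the coding map *)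

Definition prefix_perm_inv (k m : nat) (h : block_code k m.+1) (a : 'I_k)
    (v : word k m) : word k m :=
  if [pick u : m.-tuple 'I_k | prefix_perm h [:: a] u == v] is Some u
  then u else v.

(** The symbol at -1 of [p.1] is the one at 0 of its preimage under the shift,
    hence the letter whose prefix permutation has to be undone. *)
Definition skew_inv (k m : nat) (h : block_code k m.+1)
    (p : full_shift k * word k m) : full_shift k * word k m :=
  (right_shift p.1, prefix_perm_inv h (p.1 (- 1)%R) p.2).

Definition xi_at (k m : nat) (h : block_code k m.+1)
    (p : full_shift k * word k m) : m.+1.-tuple 'I_k :=
  xi_letter h (p.1 0%R) p.2.

(** The first letter of [xi_at h (gamma_map h x)] is [x 0], and the skew map
    shifts [x]; so its [n]-th iterate reads off the [n]-th coordinate. *)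
Definition gamma_inv (k m : nat) (h : block_code k m.+1)
    (p : full_shift k * word k m) : full_shift k :=
  fun n => thead (xi_at h (iterz (skew_map h) (skew_inv h) n p)).

Section SkewProduct.
Context (k m : nat) (h : block_code k m.+1).

Lemma continuous_sliding : continuous (sliding_block_code h).
Proof.
apply: continuous_full_shift => n.
apply: (@continuous_discrete _ (discrete_topology 'I_k)) => x.
by move: (near_window n m.+1 x); apply: filterS => z; rewrite /sliding_block_code => ->.
Qed.

Lemma continuous_gamma : continuous (gamma_map h).
Proof.
apply: continuous_pair; first exact: continuous_sliding.
apply: (@continuous_discrete _ (discrete_topology (m.-tuple 'I_k))) => x.
exact: near_window.
Qed.

Lemma continuous_coord_fst n :
  continuous (fun p : full_shift k * word k m => p.1 n : discrete_topology 'I_k).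
Proof.
move=> p; apply: (@continuous_comp _ _ _ fst (fun x : full_shift k => x n)).
  exact: cvg_fst.
exact: continuous_coord.
Qed.

Lemma continuous_snd_word :
  continuous (fun p : full_shift k * word k m => p.2).
Proof. by move=> p; exact: cvg_snd. Qed.

Lemma continuous_skew : continuous (skew_map h).
Proof.
apply: continuous_pair; last first.
  exact (@continuous_discrete2 _ (discrete_topology 'I_k)
    (discrete_topology (m.-tuple 'I_k)) (discrete_topology (m.-tuple 'I_k))
    (fun a => prefix_perm h [:: a]) _ _ (@continuous_coord_fst 0%R) continuous_snd_word).
by apply: continuous_full_shift => n; exact: continuous_coord_fst.
Qed.

Lemma continuous_skew_inv : continuous (skew_inv h).
Proof.
apply: continuous_pair; last first.
  exact (@continuous_discrete2 _ (discrete_topology 'I_k)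
    (discrete_topology (m.-tuple 'I_k)) (discrete_topology (m.-tuple 'I_k))
    (prefix_perm_inv h) _ _ (@continuous_coord_fst (- 1)%R) continuous_snd_word).
by apply: continuous_full_shift => n; exact: continuous_coord_fst.
Qed.

Lemma continuous_gamma_inv : continuous (gamma_inv h).
Proof.
apply: continuous_full_shift => n p.
apply: (@continuous_comp _ _ (discrete_topology 'I_k)
  (iterz (skew_map h) (skew_inv h) n) (fun q => thead (xi_at h q))).
  exact: (continuous_iterz continuous_skew continuous_skew_inv).
exact (@continuous_discrete2 _ (discrete_topology 'I_k)
  (discrete_topology (m.-tuple 'I_k)) (discrete_topology 'I_k)
  (fun a u => thead (xi_letter h a u)) _ _ (@continuous_coord_fst 0%R) continuous_snd_word _).
Qed.

Context (hP : permutative h).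

Lemma prefix_permK a : cancel (prefix_perm h [:: a]) (prefix_perm_inv h a).
Proof.
move=> u; rewrite /prefix_perm_inv; case: pickP => [v /eqP|/(_ u)].
  exact: prefix_perm_inj.
by rewrite eqxx.
Qed.

Lemma prefix_perm_invK a : cancel (prefix_perm_inv h a) (prefix_perm h [:: a]).
Proof.
have bij : @bijective (m.-tuple 'I_k) (m.-tuple 'I_k) (prefix_perm h [:: a]).
  exact: injF_bij (@prefix_perm_inj k m h hP a).
by apply/(bij_can_sym bij); exact: prefix_permK.
Qed.

Lemma skewK : cancel (skew_map h) (skew_inv h).
Proof.
case=> y u; congr pair => /=; first exact: left_shiftK.
by rewrite /left_shift addNr prefix_permK.
Qed.

Lemma skew_invK : cancel (skew_inv h) (skew_map h).
Proof.
case=> y u; congr pair => /=; first exact: right_shiftK.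
by rewrite /right_shift add0r prefix_perm_invK.
Qed.

(** The word [x_0 ... x_m] has the prefix and the image under [h] that
    characterize xi. *)
Lemma xi_at_gamma x : xi_at h (gamma_map h x) = window x 0%R m.+1.
Proof. by apply: xi_letter_unique => //; exact: take_window. Qed.

Lemma gamma_left_shift : {morph gamma_map h : x / left_shift x >-> skew_map h x}.
Proof.
move=> x; congr pair.
  apply/funext => n; congr h; apply: eq_from_tnth => i.
  by rewrite !tnth_mktuple /left_shift addrAC.
apply: val_inj; rewrite [RHS]prefix_permE //.
rewrite -/(xi_at h (gamma_map h x)) xi_at_gamma.
apply: (@eq_from_nth _ (x 0%R)) => [|i].
  by rewrite size_behead !size_tuple.
rewrite size_tuple => im; rewrite nth_behead.
rewrite (nth_mktuple _ _ (Ordinal im)).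
rewrite (nth_mktuple _ _ (Ordinal (im : (i.+1 < m.+1)%N))).
by rewrite /left_shift !add0r -PoszD addn1.
Qed.

Lemma gamma_right_shift : {morph gamma_map h : x / right_shift x >-> skew_inv h x}.
Proof.
by move=> x; rewrite -{2}[x]right_shiftK gamma_left_shift skewK.
Qed.

Lemma gammaK : cancel (gamma_map h) (gamma_inv h).
Proof.
move=> x; apply/funext => n; rewrite /gamma_inv.
rewrite -(iterz_semiconj gamma_left_shift gamma_right_shift) xi_at_gamma.
by rewrite [thead _]tnth_mktuple iterz_shift !add0r.
Qed.

(** By construction, without knowing yet that [gamma_inv] inverts [gamma_map]:
    applying the skew map to [p] shifts the sequence of its iterates. *)
Lemma gamma_inv_skew : {morph gamma_inv h : p / skew_map h p >-> left_shift p}.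
Proof.
by move=> p; apply/funext => n; rewrite /gamma_inv (iterz_add1 skewK skew_invK).
Qed.

Lemma gamma_inv_skew_inv :
  {morph gamma_inv h : p / skew_inv h p >-> right_shift p}.
Proof.
by move=> p; rewrite -{2}[p]skew_invK gamma_inv_skew left_shiftK.
Qed.

(** The skew map drops the first letter of xi and keeps the others as the prefix
    of the next xi. So the letters of xi are the first letters of the successive
    xi's, which [gamma_inv] collects. *)
Lemma window_gamma_inv p : window (gamma_inv h p) 0%R m.+1 = xi_at h p.
Proof.
suff E i : (i <= m)%N -> forall q,
    gamma_inv h q (Posz i) = nth (q.1 0%R) (xi_at h q) i.
  apply: eq_from_tnth => i; rewrite [LHS]tnth_mktuple (tnth_nth (p.1 0%R)).
  by rewrite -(E i (ltn_ord i) p); congr (gamma_inv h p _); exact: add0r.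
elim: i => [_ q|i IH im q].
  by rewrite /gamma_inv /= [thead _](tnth_nth (q.1 0%R)).
(* The letter at i+1 of the point built from q is the one at i of the point
   built from its image under the skew map. *)
have := IH (ltnW im) (skew_map h q); rewrite gamma_inv_skew /left_shift.
rewrite -PoszD addn1 => ->.
rewrite -[LHS](nth_take _ im) (take_xi_letter hP) [X in nth _ X](prefix_permE hP).
by rewrite nth_behead; apply: set_nth_default; rewrite size_tuple.
Qed.

(** The symbol at [n] of the image is determined by the window at [n], which is
    the window at 0 of the point built from the [n]-th iterate of [p]. *)
Lemma gamma_invK : cancel (gamma_inv h) (gamma_map h).
Proof.
case=> y u; congr pair.
  apply/funext => n; rewrite /sliding_block_code.
  pose q := iterz (skew_map h) (skew_inv h) n (y, u).
  have -> : window (gamma_inv h (y, u)) n m.+1 = window (gamma_inv h q) 0%R m.+1.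
    apply: eq_from_tnth => i; rewrite !tnth_mktuple.
    rewrite (iterz_semiconj gamma_inv_skew gamma_inv_skew_inv) iterz_shift.
    by rewrite add0r addrC.
  rewrite window_gamma_inv (code_xi_letter hP).
  have fstM : {morph fst : p / skew_map h p >-> left_shift p} by [].
  have fstM' : {morph fst : p / skew_inv h p >-> right_shift p} by [].
  by rewrite (iterz_semiconj fstM fstM') iterz_shift add0r.
apply: val_inj; apply: etrans (take_xi_letter hP (y 0%R) u).
by rewrite -/(xi_at h (y, u)) -window_gamma_inv take_window.
Qed.

End SkewProduct.

Theorem theorem1p3 (k l : nat) (hk : (0 < k)%N) (hl : (0 < l)%N)
    (h : block_code k l) (hperm : permutative h)
    (Y : set (full_shift k)) (hY : subshift Y) :
  let X := sliding_block_code h @^-1` Y in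
  let Z := Y `*` [set: word k l.-1] in
  [/\ homeomorphism X Z (gamma_map h),
      homeomorphism Z Z (skew_map h) &
      conjugacy X (@left_shift k) Z (skew_map h) (gamma_map h)].
Proof.
case: l hl h hperm => // m _ h hP X Z.
have gammaX : X = gamma_map h @^-1` Z by apply/seteqP; split=> x //= -[].
have skewZ : Z = skew_map h @^-1` Z.
  apply/seteqP; split=> p [Yp _]; split=> //.
    exact/(subshift_left_shift p.1 hY).
  exact/(subshift_left_shift p.1 hY).
have gammaH : homeomorphism X Z (gamma_map h).
  exact: homeomorphism_restrict (gammaK hP) (gamma_invK hP)
    (@continuous_gamma k m h) (@continuous_gamma_inv k m h) gammaX.
split=> //.
  exact: homeomorphism_restrict (skewK hP) (skew_invK hP)
    (@continuous_skew k m h) (@continuous_skew_inv k m h) skewZ.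
split=> // [x|p|x _]; last exact: gamma_left_shift.
  by rewrite gammaX /= gamma_left_shift // {1}skewZ.
by rewrite {1}skewZ.
Qed.
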